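(* Let $(R,\mathfrak m)$ be a $1$-dimensional noetherian local integral domain which is not complete in the $\mathfrak m$-adic topology, and let $\widehat R$ be its $\mathfrak m$-adic completion. Then $\operatorname{pd}_R(\widehat R)=1$. In particular, $\operatorname{Ext}^i_R(\widehat R,R)=0$ for all $i\ge 2$.
   Context: $\operatorname{pd}_R$ denotes projective dimension. *)

(* Defs.v *)
From HB Require Import structures.
From mathcomp Require Import all_boot all_order all_algebra.
From mathcomp Require Import mathcomp_extra boolp.

Set Implicit Arguments.
Unset Strict Implicit.
Unset Printing Implicit Defensive.

Import GRing.Theory.
Local Open Scope ring_scope.
Local Open Scope quotient_scope.

Section LModules.
Variable R : comNzRingType.

Section Submod.
Variables (V : lmodType R) (S : submodClosed V).
Record submod : Type := Submod { submod_val : V; _ : submod_val \in S }.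
HB.instance Definition _ := [isSub for submod_val].
HB.instance Definition _ := [Choice of submod by <:].
HB.instance Definition _ := [SubChoice_isSubLmodule of submod by <:].
End Submod.

Section Quotmod.
Variables (V : lmodType R) (S : submodClosed V).

(* A submodClosed predicate is not canonically a zmodClosed one, which is what
   Quotient.quot expects. *)
Definition submod_pred : {pred V} := fun x => x \in S.
Fact submod_pred_zmod_closed : zmod_closed submod_pred.
Proof. exact: (submodClosedP S : zmod_closed _). Qed.
HB.instance Definition _ :=
  GRing.isZmodClosed.Build V submod_pred submod_pred_zmod_closed.

Definition quotmod : Type := Quotient.quot submod_pred.
HB.instance Definition _ := GRing.Zmodule.on quotmod.

Definition quotmod_pi (x : V) : quotmod := \pi_(Quotient.quot submod_pred) x.
Definition quotmod_scale (a : R) (x : quotmod) : quotmod :=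
  quotmod_pi (a *: repr (x : Quotient.quot submod_pred)).

Lemma quotmod_piP (x y : V) :
  quotmod_pi x = quotmod_pi y <-> x - y \in (S : {pred V}).
Proof.
rewrite /quotmod_pi -[x - y \in _]/(x - y \in submod_pred).
by rewrite Quotient.idealrBE; split=> /eqP.
Qed.

Lemma quotmod_piD (x y : V) :
  quotmod_pi (x + y) = quotmod_pi x + quotmod_pi y.
Proof. exact: Quotient.pi_add. Qed.

Lemma quotmod_piK (x : quotmod) :
  quotmod_pi (repr (x : Quotient.quot submod_pred)) = x.
Proof. exact: reprK. Qed.

Lemma quotmod_piZ a (x : V) : quotmod_scale a (quotmod_pi x) = quotmod_pi (a *: x).
Proof.
apply/quotmod_piP; rewrite -scalerBr rpredZ //.
by apply/quotmod_piP; rewrite quotmod_piK.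
Qed.

Lemma quotmod_pi_surj (x : quotmod) : exists v, x = quotmod_pi v.
Proof. by exists (repr (x : Quotient.quot submod_pred)); rewrite quotmod_piK. Qed.

Fact quotmod_scaleA a b (x : quotmod) :
  quotmod_scale a (quotmod_scale b x) = quotmod_scale (a * b) x.
Proof. by have [v ->] := quotmod_pi_surj x; rewrite !quotmod_piZ scalerA. Qed.

Fact quotmod_scale1 : left_id 1 quotmod_scale.
Proof.
by move=> x; have [v ->] := quotmod_pi_surj x; rewrite quotmod_piZ scale1r.
Qed.

Fact quotmod_scaleDr : right_distributive quotmod_scale +%R.
Proof.
move=> a x y; have [v ->] := quotmod_pi_surj x.
have [w ->] := quotmod_pi_surj y.
by rewrite !quotmod_piZ -!quotmod_piD quotmod_piZ scalerDr.
Qed.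

Fact quotmod_scaleDl x : {morph quotmod_scale^~ x : a b / a + b}.
Proof.
move=> a b /=; have [v ->] := quotmod_pi_surj x.
by rewrite !quotmod_piZ -!quotmod_piD scalerDl.
Qed.

HB.instance Definition _ := GRing.Zmodule_isLmodule.Build R quotmod
  quotmod_scaleA quotmod_scale1 quotmod_scaleDr quotmod_scaleDl.

Fact quotmod_pi_linear : linear quotmod_pi.
Proof. by move=> a x y; rewrite quotmod_piD -quotmod_piZ. Qed.

HB.instance Definition _ :=
  GRing.isLinear.Build R V quotmod _ quotmod_pi quotmod_pi_linear.
End Quotmod.

Definition dprod (I : Type) (V : I -> lmodType R) : Type := forall i, V i.

Section Dprod.
Variables (I : Type) (V : I -> lmodType R).
Local Notation T := (dprod V).
HB.instance Definition _ := gen_eqMixin T.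
HB.instance Definition _ := gen_choiceMixin T.

Definition dprod0 : T := fun=> 0.
Definition dprodN (f : T) : T := fun i => - f i.
Definition dprodD (f g : T) : T := fun i => f i + g i.
Definition dprodZ (a : R) (f : T) : T := fun i => a *: f i.

Fact dprodDA : associative dprodD.
Proof. by move=> f g h; apply: functional_extensionality_dep => i; exact: addrA. Qed.
Fact dprodDC : commutative dprodD.
Proof. by move=> f g; apply: functional_extensionality_dep => i; exact: addrC. Qed.
Fact dprod0D : left_id dprod0 dprodD.
Proof. by move=> f; apply: functional_extensionality_dep => i; exact: add0r. Qed.
Fact dprodND : left_inverse dprod0 dprodN dprodD.
Proof. by move=> f; apply: functional_extensionality_dep => i; exact: addNr. Qed.
HB.instance Definition _ :=
  GRing.isZmodule.Build T dprodDA dprodDC dprod0D dprodND.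

Fact dprodZA a b f : dprodZ a (dprodZ b f) = dprodZ (a * b) f.
Proof. by apply: functional_extensionality_dep => i; exact: scalerA. Qed.
Fact dprodZ1 : left_id 1 dprodZ.
Proof. by move=> f; apply: functional_extensionality_dep => i; exact: scale1r. Qed.
Fact dprodZDr : right_distributive dprodZ +%R.
Proof. by move=> a f g; apply: functional_extensionality_dep => i; exact: scalerDr. Qed.
Fact dprodZDl f : {morph dprodZ^~ f : a b / a + b}.
Proof. by move=> a b; apply: functional_extensionality_dep => i; exact: scalerDl. Qed.
HB.instance Definition _ :=
  GRing.Zmodule_isLmodule.Build R T dprodZA dprodZ1 dprodZDr dprodZDl.
End Dprod.

Definition lhom (U V : lmodType R) : Type := {linear U -> V}.

Section Lhom.
Variables U V : lmodType R.
Local Notation T := (lhom U V).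
Implicit Types f g h : T.

Lemma lhomP f g : (forall x, f x = g x) -> f = g.
Proof.
case: f g => [f [[af] [lf]]] [g [[ag] [lg]]] /= /funext fg.
case: _ / fg ag lg => ag lg.
by rewrite (Prop_irrelevance af ag) (Prop_irrelevance lf lg).
Qed.

HB.instance Definition _ := gen_eqMixin T.
HB.instance Definition _ := gen_choiceMixin T.

Definition lhom0 : T := \0.
Definition lhomN f : T := \- f.
Definition lhomD f g : T := f \+ g.
Definition lhomZ (a : R) f : T := a \*: f.

Fact lhomDA : associative lhomD.
Proof. by move=> f g h; apply: lhomP => x; exact: addrA. Qed.
Fact lhomDC : commutative lhomD.
Proof. by move=> f g; apply: lhomP => x; exact: addrC. Qed.
Fact lhom0D : left_id lhom0 lhomD.
Proof. by move=> f; apply: lhomP => x; exact: add0r. Qed.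
Fact lhomND : left_inverse lhom0 lhomN lhomD.
Proof. by move=> f; apply: lhomP => x; exact: addNr. Qed.
HB.instance Definition _ := GRing.isZmodule.Build T lhomDA lhomDC lhom0D lhomND.

Fact lhomZA a b f : lhomZ a (lhomZ b f) = lhomZ (a * b) f.
Proof. by apply: lhomP => x; exact: scalerA. Qed.
Fact lhomZ1 : left_id 1 lhomZ.
Proof. by move=> f; apply: lhomP => x; exact: scale1r. Qed.
Fact lhomZDr : right_distributive lhomZ +%R.
Proof. by move=> a f g; apply: lhomP => x; exact: scalerDr. Qed.
Fact lhomZDl f : {morph lhomZ^~ f : a b / a + b}.
Proof. by move=> a b; apply: lhomP => x; exact: scalerDl. Qed.
HB.instance Definition _ :=
  GRing.Zmodule_isLmodule.Build R T lhomZA lhomZ1 lhomZDr lhomZDl.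
End Lhom.

Definition lhom_pre (U U' V : lmodType R) (d : {linear U' -> U})
  (f : lhom U V) : lhom U' V := f \o d.

Fact lhom_pre_linear (U U' V : lmodType R) (d : {linear U' -> U}) :
  linear (@lhom_pre U U' V d).
Proof. by move=> a f g; apply: lhomP. Qed.

HB.instance Definition _ (U U' V : lmodType R) (d : {linear U' -> U}) :=
  GRing.isLinear.Build R (lhom U V) (lhom U' V) _ (@lhom_pre U U' V d)
    (@lhom_pre_linear U U' V d).

Definition projective (P : lmodType R) : Prop :=
  forall (M N : lmodType R) (g : {linear M -> N}) (f : {linear P -> N}),
    (forall y, exists x, g x = y) ->
  exists h : {linear P -> M}, forall x, g (h x) = f x.

Record proj_resolution (M : lmodType R) := ProjResolution {
  res_mod :> nat -> lmodType R;
  res_d : forall n, {linear res_mod n.+1 -> res_mod n};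
  res_aug : {linear res_mod 0%N -> M};
  res_proj : forall n, projective (res_mod n);
  res_aug_surj : forall x, exists y, res_aug y = x;
  res_exact0 : forall y, res_aug y = 0 <-> exists z, res_d 0%N z = y;
  res_exact : forall n y, res_d n y = 0 <-> exists z, res_d n.+1 z = y
}.

Definition pd_le (M : lmodType R) (n : nat) : Prop :=
  exists P : proj_resolution M, forall k, (n < k)%N -> forall x : P k, x = 0.

Definition has_pd (M : lmodType R) (n : nat) : Prop :=
  pd_le M n /\ forall k, pd_le M k -> (n <= k)%N.

Section Ext.
Variables (M : lmodType R) (P : proj_resolution M) (N : lmodType R) (i : nat).

Definition is_coboundary : lhom (P i) N -> Prop :=
  match i return lhom (P i) N -> Prop with
  | 0 => fun f => f = 0
  | j.+1 => fun f => exists g : lhom (P j) N, f = lhom_pre (res_d P j) g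
  end.

Fact is_coboundary_linear : is_coboundary 0 /\
  forall a f g, is_coboundary f -> is_coboundary g -> is_coboundary (a *: f + g).
Proof.
rewrite /is_coboundary; case: i => [|j].
  by split=> // a _ _ -> ->; rewrite scaler0 addr0.
split=> [|a _ _ [u ->] [v ->]]; first by exists 0; rewrite linear0.
by exists (a *: u + v); rewrite linearP.
Qed.

Definition cocycle : {pred lhom (P i) N} :=
  fun f => lhom_pre (res_d P i) f == 0.

Fact cocycle_submod_closed : submod_closed cocycle.
Proof.
split; first by rewrite unfold_in linear0.
move=> a f g /eqP f0 /eqP g0; rewrite unfold_in; apply/eqP.
by move: (lhom_pre_linear (res_d P i) a f g); rewrite f0 g0 scaler0 addr0.
Qed.
HB.instance Definition _ :=
  GRing.isSubmodClosed.Build R (lhom (P i) N) cocycle cocycle_submod_closed.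

Definition coboundary : {pred submod cocycle} :=
  fun f => `[< is_coboundary (\val f) >].

Fact coboundary_submod_closed : submod_closed coboundary.
Proof.
have [c0 cl] := is_coboundary_linear; split; first exact/asboolP.
by move=> a f g /asboolP fc /asboolP gc; apply/asboolP; exact: cl.
Qed.
HB.instance Definition _ := GRing.isSubmodClosed.Build R (submod cocycle)
  coboundary coboundary_submod_closed.

(* The i-th cohomology of Hom_R(P, N), i.e. Ext^i_R(M, N) computed from the
   projective resolution P of M. *)
Definition Ext : lmodType R := quotmod coboundary.
End Ext.

(* submodClosed R^o: all ideals, the unit ideal included; idealr R, used below,
   contains only the proper ones. *)
Definition noetherian : Prop :=
  forall I : submodClosed R^o, exists s : seq R,
    forall x : R, (x \in I) <->
      exists c : 'I_(size s) -> R, x = \sum_(k < size s) c k * s`_k.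

Definition maximal_ideal (m : idealr R) : Prop :=
  forall J : idealr R, {subset m <= J} -> {subset J <= m}.

Definition local_ring (m : idealr R) : Prop :=
  maximal_ideal m /\ forall J : idealr R, maximal_ideal J -> J =i m.

Definition prime_chain (n : nat) : Prop :=
  exists p : nat -> prime_idealr R, forall i, (i < n)%N ->
    {subset p i <= p i.+1} /\ ~ {subset p i.+1 <= p i}.

Definition has_krull_dim (n : nat) : Prop :=
  prime_chain n /\ forall k, prime_chain k -> (k <= n)%N.

Section Completion.
Variable m : idealr R.

Fixpoint ideal_pow (n : nat) : {pred R^o} :=
  if n is n'.+1 then
    fun x => `[< exists s : seq (R * R),
      (forall u, u \in s -> u.1 \in m /\ u.2 \in ideal_pow n')
      /\ x = \sum_(u <- s) u.1 * u.2 >]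
  else predT.

Fact ideal_pow_submod_closed n : submod_closed (ideal_pow n).
Proof.
elim: n => [//|n IHn]; split.
  by apply/asboolP; exists [::]; rewrite big_nil.
move=> a x y /asboolP[s [Hs ->]] /asboolP[t [Ht ->]]; apply/asboolP.
exists ([seq (u.1, a * u.2) | u <- s] ++ t); split; last first.
  rewrite big_cat big_map /= scaler_sumr; congr (_ + _).
  by apply: eq_bigr => u _; rewrite mulrCA.
move=> u; rewrite mem_cat => /orP[/mapP[v /Hs[v1 v2] ->]|/Ht//]; split=> //=.
by have [c0 cl] := IHn; rewrite -[a * _]addr0; apply: cl.
Qed.

HB.instance Definition _ n :=
  GRing.isSubmodClosed.Build R R^o (ideal_pow n) (ideal_pow_submod_closed n).

Definition adic_quot (n : nat) : lmodType R := quotmod (ideal_pow n).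

Definition adic_proj (n : nat) (a : R) : adic_quot n := quotmod_pi (ideal_pow n) a.

(* The transition map R/m^(n+1) -> R/m^n sends the class of a to the class of a. *)
Definition coherent : {pred dprod adic_quot} :=
  fun x => `[< forall n (a : R), x n.+1 = adic_proj n.+1 a -> x n = adic_proj n a >].

Lemma ideal_powS n x : x \in ideal_pow n.+1 -> x \in ideal_pow n.
Proof.
move=> /asboolP[s [Hs ->]]; have [c0 cl] := ideal_pow_submod_closed n.
rewrite big_seq; elim/big_rec: _ => // u y /Hs[_ u2] yn; exact: cl.
Qed.

Lemma adic_projS n (a b : R) :
  adic_proj n.+1 a = adic_proj n.+1 b -> adic_proj n a = adic_proj n b.
Proof. by move=> /quotmod_piP ab; apply/quotmod_piP; exact: ideal_powS. Qed.

Fact coherent_submod_closed : submod_closed coherent.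
Proof.
split.
  have adic_proj0 k : adic_proj k 0 = 0 by exact: linear0.
  apply/asboolP => n a; move=> a0; rewrite -[LHS]/(0 : adic_quot n) -adic_proj0.
  by apply: adic_projS; rewrite adic_proj0 -a0.
move=> a x y /asboolP xc /asboolP yc; apply/asboolP => n b.
have [u xu] := quotmod_pi_surj (x n.+1); have [v yv] := quotmod_pi_surj (y n.+1).
rewrite -[LHS]/(a *: x n.+1 + y n.+1) -[(a *: x + y) n]/(a *: x n + y n).
rewrite (xc _ _ xu) (yc _ _ yv) xu yv -!quotmod_pi_linear.
exact: adic_projS.
Qed.
HB.instance Definition _ := GRing.isSubmodClosed.Build R (dprod adic_quot)
  coherent coherent_submod_closed.

(* The inverse limit of the R/m^n, only as an R-module (its ring structure is
   irrelevant to homological dimensions). *)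
Definition completion : lmodType R := submod coherent.

Fact adic_proj_coherent (a : R) : (adic_proj^~ a : dprod adic_quot) \in coherent.
Proof. by apply/asboolP => n b; exact: adic_projS. Qed.

Definition to_completion (a : R) : completion := Submod (adic_proj_coherent a).

Definition adically_complete : Prop := bijective to_completion.
End Completion.
End LModules.

Arguments noetherian : clear implicits.
Arguments has_krull_dim : clear implicits.
Arguments is_coboundary {R M} P N i.
Arguments cocycle {R M} P N i.
Arguments coboundary {R M} P N i.
Arguments coherent {R} m.

(* Main.v *)
(** Let [x] be a nonzero element of the maximal ideal [m]. In dimension one
    every nonzero ideal contains a power of [m]; hence on the cokernel of [R] in its
    completion [C] every nonzero element of [R] acts bijectively, so that the
    cokernel is a vector space over the fraction field [R[1/x]]. A maximal
    family [v_k] in [C] that is independent modulo [R] provides a basis, and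
    choosing [y_(k,0) = v_k] and [y_(k,n) - x y_(k,n+1) = r_(k,n)] in [R] gives
    a free resolution of [C] of length one: the generators are [1] and the
    [y_(k,n)], the relations are exactly these equations.

    If [C] were projective, a linear [f : C -> R] with [f 1 <> 0] would exist.
    The map [y |-> f(y) 1 - f(1) y] vanishes on [R], so it factors through a
    divisible module, and [C] is separated; hence [f(1) y] lies in [R] for all
    [y], and then [y] itself does, so [R] would be complete. *)
Require Import Defs.
From HB Require Import structures.
From mathcomp Require Import all_boot all_order all_algebra.
From mathcomp Require Import boolp classical_sets.
From mathcomp Require Import freeg.

Set Implicit Arguments.
Unset Strict Implicit.
Unset Printing Implicit Defensive.

Import GRing.Theory.
Local Open Scope ring_scope.

(** * Vanishing of Ext beyond the length of a resolution *)

Section LinearRange.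
Variables (R : comNzRingType) (M N : lmodType R) (g : {linear M -> N}).

Definition lrange : {pred N} := fun y => `[< exists x, g x = y >].

Fact lrange_submod_closed : submod_closed lrange.
Proof.
split; first by apply/asboolP; exists 0; rewrite linear0.
move=> a _ _ /asboolP[x <-] /asboolP[y <-].
by apply/asboolP; exists (a *: x + y); rewrite linearP.
Qed.
HB.instance Definition _ :=
  GRing.isSubmodClosed.Build R N lrange lrange_submod_closed.

Section Corestriction.
Variables (P : lmodType R) (f : {linear P -> N}).
Hypothesis fg : forall x, exists y, g y = f x.

Fact corestr_in x : f x \in lrange. Proof. exact/asboolP/fg. Qed.
Definition corestr x : submod lrange := Submod (corestr_in x).
Fact corestr_linear : linear corestr.
Proof. by move=> a x y; apply: val_inj; rewrite /= linearP. Qed.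
HB.instance Definition _ :=
  GRing.isLinear.Build R P (submod lrange) _ corestr corestr_linear.
End Corestriction.

(** [projective] lifts only along surjections, so both maps are first corestricted to the image of
    [g]. *)
Lemma projective_lift (P : lmodType R) (f : {linear P -> N}) :
  projective P -> (forall x, exists y, g y = f x) ->
  exists h : {linear P -> M}, forall x, g (h x) = f x.
Proof.
move=> Pproj fg; have gg x : exists y, g y = g x by exists x.
have [[y yg]|h hP] := Pproj _ _ (corestr gg) (corestr fg).
  by have /asboolP[x gx] := yg; exists x; apply: val_inj.
by exists h => x; have /(congr1 val) := hP x.
Qed.
End LinearRange.

Section ExtVanishing.
Variables (R : comNzRingType) (M : lmodType R) (P : proj_resolution M).

Lemma res_dd n x : res_d P n (res_d P n.+1 x) = 0.
Proof. by apply/res_exact; exists x. Qed.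

Lemma res_aug_d x : res_aug P (res_d P 0 x) = 0.
Proof. by apply/res_exact0; exists x. Qed.

(* [res_d P n (h (res_d P n x)) = res_d P n x] says that the image of
   [res_d P n] is a direct summand, with projection [res_d P n \o h]. *)
Lemma res_splitS n (h : {linear P n -> P n.+1}) :
  (forall x, res_d P n (h (res_d P n x)) = res_d P n x) ->
  exists k : {linear P n.+1 -> P n.+2},
    forall x, res_d P n.+1 (k (res_d P n.+1 x)) = res_d P n.+1 x.
Proof.
(* By [hd], [f] lands in the kernel of [res_d P n] when composed with nothing else, so it lifts
   through [res_d P n.+1]; on the image of [res_d P n.+1] it is the identity. *)
move=> hd; pose f : {linear P n.+1 -> P n.+1} := idfun \- (h \o res_d P n).
have [|k kP] := projective_lift (g := res_d P n.+1) (f := f) (@res_proj _ _ P _).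
  by move=> x; apply/res_exact; rewrite linearB /= hd subrr.
by exists k => x; rewrite kP /= res_dd linear0 subr0.
Qed.

(** Comparison with a resolution [Q] of length one: chain maps [p], [q] over the identity of [M],
    and a homotopy between [q p] and the identity. In degree one [q1 \o p1] dies on boundaries,
    since [p1] sends them into the kernel of [res_d Q 0], the image of [Q 2 = 0]. *)
Lemma res_split1 : pd_le M 1 -> exists h : {linear P 1%N -> P 2},
  forall x, res_d P 1 (h (res_d P 1 x)) = res_d P 1 x.
Proof.
case=> Q Q0.
have [x|p0 p0P] :=
  projective_lift (g := res_aug Q) (f := res_aug P) (@res_proj _ _ P 0).
  exact: res_aug_surj.
have [x|q0 q0P] :=
  projective_lift (g := res_aug P) (f := res_aug Q) (@res_proj _ _ Q 0).
  exact: res_aug_surj.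
have [x|p1 p1P] := projective_lift (g := res_d Q 0)
  (f := p0 \o res_d P 0) (@res_proj _ _ P 1).
  by apply/res_exact0; rewrite /= p0P; exact: res_aug_d.
have [x|q1 q1P] := projective_lift (g := res_d P 0)
  (f := q0 \o res_d Q 0) (@res_proj _ _ Q 1).
  by apply/res_exact0; rewrite /= q0P; apply/res_exact0; exists x.
pose f0 : {linear P 0%N -> P 0%N} := idfun \- (q0 \o p0).
have [x|h0 h0P] := projective_lift (g := res_d P 0) (f := f0) (@res_proj _ _ P 0).
  by apply/res_exact0; rewrite linearB /= q0P p0P subrr.
pose f1 : {linear P 1%N -> P 1%N} :=
  idfun \- ((q1 \o p1) \+ (h0 \o res_d P 0)).
have [x|h1 h1P] := projective_lift (g := res_d P 1) (f := f1) (@res_proj _ _ P 1).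
  apply/res_exact; rewrite linearB linearD /= q1P h0P /= p1P /=.
  by rewrite addrCA subrr addr0 subrr.
exists h1 => x; rewrite h1P /= res_dd linear0 addr0.
suff -> : p1 (res_d P 1 x) = 0 by rewrite linear0 subr0.
have /res_exact[z <-] : res_d Q 0 (p1 (res_d P 1 x)) = 0.
  by rewrite p1P /= res_dd linear0.
by rewrite (Q0 2%N isT z) linear0.
Qed.

(** A cocycle [f] is the coboundary of [f \o h]: the splitting makes [h (res_d P i.+1 x) - x] a
    cycle, hence a boundary, and [f] vanishes on boundaries. *)
Lemma Ext_pd_le1 (N : lmodType R) i : pd_le M 1 -> (2 <= i)%N ->
  forall e : Ext P N i, e = 0.
Proof.
case: i => [|[|i]] // pd1 _ e.
have [h hP] : exists h : {linear P i.+1 -> P i.+2},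
    forall x, res_d P i.+1 (h (res_d P i.+1 x)) = res_d P i.+1 x.
  elim: i {e} => [|i [h hP]]; first exact: res_split1.
  exact: res_splitS hP.
have [[f fc] ->] := quotmod_pi_surj e; rewrite -(linear0 (@quotmod_pi _ _ _)).
apply/quotmod_piP; rewrite subr0; apply/asboolP => /=.
exists (lhom_pre h f); apply: lhomP => x /=.
apply/esym/eqP; rewrite -subr_eq0 -linearB; apply/eqP.
have /res_exact[z <-] : res_d P i.+1 (h (res_d P i.+1 x) - x) = 0.
  by rewrite linearB hP subrr.
by have /eqP/(congr1 (fun g : lhom _ _ => g z)) := fc.
Qed.
End ExtVanishing.

(** * Free modules *)

Section FreeModule.
Variables (R : comNzRingType) (K : choiceType).
Implicit Types (M : lmodType R) (k : K) (u : {freeg K / R}).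

Lemma freegUZ (a : R) k : << a *g k >> = a *: << k >> :> {freeg K / R}.
Proof. by apply/eqP/freeg_eqP => j; rewrite coeffZ !coeffU mul1r. Qed.

Lemma freeg_ind (Q : {freeg K / R} -> Prop) :
  (forall k, Q << k >>) -> Q 0 -> (forall u v, Q u -> Q v -> Q (u + v)) ->
  (forall a u, Q u -> Q (a *: u)) -> forall u, Q u.
Proof.
move=> QU Q0 QD QZ u; rewrite -[u]freeg_sumE.
by elim/big_ind: _ => // k _; rewrite freegUZ; apply/QZ/QU.
Qed.

Section Lift.
Variables (M : lmodType R) (f : K -> M).
Let fB : {morph fglift f : u v / u - v} := lift_is_additive f.

Let f0 : fglift f 0 = 0.
Proof. by have := fB 0 0; rewrite !subrr. Qed.

Let fD : {morph fglift f : u v / u + v}.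
Proof.
move=> u v; have fN : fglift f (- v) = - fglift f v.
  by rewrite -sub0r fB f0 sub0r.
by rewrite -{1}[v]opprK fB fN opprK.
Qed.

Fact fglift_linear : linear (fglift f).
Proof.
move=> a u v; rewrite fD; congr (_ + _).
elim/freeg_ind: u a => [k||u1 u2 IH1 IH2|b u IH] a.
- by rewrite -freegUZ !liftU scale1r.
- by rewrite scaler0 f0 scaler0.
- by rewrite scalerDr !fD IH1 IH2 scalerDr.
- by rewrite scalerA !IH scalerA.
Qed.
HB.instance Definition _ :=
  GRing.isLinear.Build R {freeg K / R} M _ (fglift f) fglift_linear.

Lemma fglift1 k : fglift f << k >> = f k.
Proof. by rewrite liftU scale1r. Qed.
End Lift.

Lemma freeg_lin_ext M (f g : {linear {freeg K / R} -> M}) :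
  (forall k, f << k >> = g << k >>) -> f =1 g.
Proof.
move=> fg; apply: freeg_ind => // [|u v fgu fgv|a u fgu].
- by rewrite !linear0.
- by rewrite !linearD fgu fgv.
- by rewrite !linearZ /= fgu.
Qed.

Lemma freeg_projective : projective {freeg K / R}.
Proof.
move=> M N g f gsurj.
have [h hP] : {h : K -> M & forall k, g (h k) = f << k >>}.
  by exists (fun k => sval (cid (gsurj (f << k >>)))) => k; case: cid.
exists (fglift h) => x.
rewrite -[LHS]/((g \o fglift h) x); apply: freeg_lin_ext => k /=.
by rewrite fglift1.
Qed.

End FreeModule.

(* A projective module embeds in a free one, and coordinates separate points. *)
Lemma projective_dual (R : comNzRingType) (M : lmodType R) (y : M) :
  projective M -> y != 0 -> exists f : {linear M -> R^o}, f y != 0.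
Proof.
move=> Mproj y0.
have [x|s sK] := Mproj {freeg M / R} M (fglift idfun) idfun.
  by exists << x >>; exact: fglift1.
have sy0 : s y != 0 by apply: contra_neq y0 => s0; rewrite -[y]sK s0 linear0.
have [k yk] : exists k, coeff k (s y) != 0.
  apply: contrapT => nex; case/negP: sy0; apply/freeg_eqP => k.
  rewrite coeff0; apply/eqP/negPn/negP => yk; apply: nex; by exists k.
have lin : linear (fun x => coeff k (s x) : R^o).
  by move=> a u v; rewrite linearP coeffD coeffZ.
pose g := GRing.isLinear.Build R M R^o _ _ lin.
pose h : {linear M -> R^o} := HB.pack (fun x => coeff k (s x) : R^o) g.
by exists h.
Qed.

(** * Resolution of an extension of a vector space by a line *)

Section Telescope.
Variables (R : comNzRingType) (M : lmodType R) (e : M) (x : R).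
(** [e_div] and [e_pure] make M / Re divisible by [x] and torsion-free; by [x_cofinal], inverting
    [x] inverts every nonzero scalar. Later [e] is the unit of the completion. *)
Hypothesis x_reg : forall a, x * a = 0 -> a = 0.
Hypothesis e_free : forall a, a *: e = 0 -> a = 0.
Hypothesis e_div : forall v : M, exists r w, v = r *: e + x *: w.
Hypothesis e_pure : forall (a : R) (v : M), a != 0 ->
  (exists r, a *: v = r *: e) -> exists r, v = r *: e.
Hypothesis x_cofinal : forall a, a != 0 -> exists n c, x ^+ n = c * a.

(* Linear independence modulo the line spanned by [e]. *)
Definition indep_mod (K : choiceType) (v : K -> M) :=
  forall (u : {freeg K / R}) r, fglift v u = r *: e -> u = 0.

(** The form suited to Zorn's lemma: all relations live in one free module on [M], and only the
    allowed support varies. *)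
Definition indep_set (S : set M) :=
  forall (u : {freeg M / R}) r, (forall s, coeff s u != 0 -> S s) ->
    fglift idfun u = r *: e -> u = 0.

Lemma indep_set_bigcup (F : set (set M)) :
  (F `<=` indep_set)%classic -> total_on F subset ->
  indep_set (\bigcup_(X in F) X)%classic.
Proof.
move=> Find Ftot u r uS ue.
(* [F] may be empty, so a member containing the finite support of [u] is sought only when that
   support is nonempty. *)
have [->|u0] := eqVneq u 0 => //.
have [X FX uX] : exists2 X, F X & forall s, s \in dom u -> X s.
  have {uS}: forall s, s \in dom u -> (\bigcup_(X in F) X)%classic s.
    by move=> s; rewrite mem_dom => /uS.
  have : dom u != [::] by rewrite dom_eq0.
  elim: (dom u) => // s l IH _ lS.
  have [|X FX Xs] := lS s; first by rewrite mem_head.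
  have [l0|l0] := eqVneq l [::].
    by exists X => // t; rewrite l0 inE => /eqP ->.
  have [t tl|Y FY Yl] := IH l0; first by apply: lS; rewrite inE tl orbT.
  have [XY|YX] := Ftot _ _ FX FY.
    by exists Y => // t; rewrite inE => /orP[/eqP -> |/Yl //]; exact: XY.
  by exists X => // t; rewrite inE => /orP[/eqP -> //|/Yl]; exact: YX.
by apply: (Find X FX u r) => // s; rewrite -mem_dom; exact: uX.
Qed.

(** Zorn gives a maximal independent set. A vector [y] outside it enters a nontrivial relation whose
    coefficient at [y] is nonzero; that coefficient serves as [a]. *)
Lemma indep_maximal : exists (K : choiceType) (v : K -> M),
  indep_mod v /\ forall y, exists a u r,
    a != 0 /\ a *: y = fglift v u + r *: e.
Proof.
have [S [Sind Smax]] := Zorn_bigcup indep_set_bigcup.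
pose K : choiceType := {s : M | `[< S s >]}.
exists K, val.
(* [emb] identifies the free module on the subtype [K] with the elements of the free module on [M]
   supported in [S]. *)
pose emb : {linear {freeg K / R} -> {freeg M / R}} :=
  fglift (fun k : K => << val k >> : {freeg M / R}).
have emb_coeff u (k : K) : coeff (val k) (emb u) = coeff k u.
  elim/freeg_ind: u => [j||u1 u2 IH1 IH2|a u IH] /=.
  - by rewrite fglift1 !coeffU.
  - by rewrite linear0 !coeff0.
  - by rewrite linearD !coeffD /= IH1 IH2.
  - by rewrite linearZ !coeffZ /= IH.
have emb_supp u s : coeff s (emb u) != 0 -> S s.
  move=> us; apply: contrapT => Ss; case/negP: us; apply/eqP.
  elim/freeg_ind: u => [j||u1 u2 IH1 IH2|a u IH] /=.
  - rewrite fglift1 coeffU.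
    have [js|] := eqVneq (val j) s; last by rewrite mulr0.
    by case: Ss; rewrite -js; have /asboolP := valP j.
  - by rewrite linear0 !coeff0.
  - by rewrite linearD !coeffD IH1 IH2 addr0.
  - by rewrite linearZ !coeffZ IH mulr0.
have emb_lift u : fglift idfun (emb u) = fglift val u :> M.
  have /(_ u)// : fglift idfun \o emb =1 fglift val :> (_ -> M).
  by apply: freeg_lin_ext => k /=; rewrite !fglift1.
have embP w : (forall s, coeff s w != 0 -> S s) -> exists u, emb u = w.
  move=> wS; rewrite -[w]freeg_sumE big_seq.
  elim/big_ind: _ => [|_ _ [u <-] [v <-]|s].
  - by exists 0; rewrite linear0.
  - by exists (u + v); rewrite linearD.
  - rewrite mem_dom => /wS Ss; have Ss' : `[< S s >] by exact/asboolP.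
    by exists (coeff s w *: << Sub s Ss' : K >>); rewrite linearZ /= fglift1 -freegUZ.
split.
  move=> u r ur; have u0 : emb u = 0.
    by apply: (Sind _ r); [exact: emb_supp|rewrite emb_lift].
  by apply/eqP/freeg_eqP => k; rewrite -emb_coeff u0 !coeff0.
move=> y; have [Sy|Sy] := pselect (S y).
  have Sy' : `[< S y >] by exact/asboolP.
  exists 1, << (Sub y Sy' : K) >>, 0.
  by rewrite oner_eq0 scale1r scale0r addr0 fglift1.
have : ~ indep_set (S `|` [set y])%classic.
  apply: Smax; split; first by move=> s; left.
  by move=> Sn; apply: Sy; apply: Sn; right.
move=> /existsNP[w /existsNP[r /not_implyP[wS /not_implyP[we w0]]]].
have [wy|wy] := eqVneq (coeff y w) 0.
  case: w0; apply: (Sind _ r) => // s sw; have [//|/= sy] := wS _ sw.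
  by move: sw; rewrite sy wy eqxx.
have [|u uP] := embP (w - << coeff y w *g y >>).
  move=> s; rewrite coeffB coeffU; have [->|ys] := eqVneq y s.
    by rewrite mulr1 subrr eqxx.
  by rewrite mulr0 subr0 => /wS [//|/= sy]; rewrite sy eqxx in ys.
exists (coeff y w), (- u), r; split=> //.
rewrite linearN /= -emb_lift uP (lift_is_additive idfun) we liftU.
by rewrite opprB subrK.
Qed.


Lemma x_pow_reg n (a : R) : x ^+ n * a = 0 -> a = 0.
Proof.
by elim: n a => [|n IH] a; rewrite ?expr0 ?mul1r // exprSr -mulrA => /IH/x_reg.
Qed.

Lemma x_pow_neq0 n : x ^+ n != 0.
Proof.
apply/eqP => xn0; have /eqP := @x_pow_reg n 1 (etrans (mulr1 _) xn0).
by rewrite oner_eq0.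
Qed.

(** * The telescope resolution *)

Section Resolution.
Variables (K : choiceType) (v : K -> M) (rr : M -> R) (ww : M -> M).
Hypothesis v_indep : indep_mod v.
Hypothesis v_gen :
  forall y, exists a u r, a != 0 /\ a *: y = fglift v u + r *: e.
Hypothesis rwP : forall y, y = rr y *: e + x *: ww y.

(* The [k]-th tower stands for [v k], [v k / x], [v k / x ^+ 2], ... taken
   modulo the line spanned by [e]. *)
Let tower k n : M := iter n ww (v k).

Let towerE k n : tower k n = rr (tower k n) *: e + x *: tower k n.+1.
Proof. exact: rwP. Qed.

(** In degree 0, [None] stands for [e] and [Some (k, n)] for [tower k n]; in degree 1 each pair
    names a relation. *)
Definition tel_index n : choiceType :=
  match n with
  | 0 => option (K * nat)
  | 1 => (K * nat)%type
  | _ => void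
  end.

Local Notation P0 := {freeg (option (K * nat)%type) / R}.
Local Notation P1 := {freeg ((K * nat)%type) / R}.

Definition tel_aug : {linear P0 -> M} :=
  fglift (fun i => if i is Some (k, n) then tower k n else e).

Definition tel_d0 : {linear P1 -> P0} :=
  fglift (fun i : K * nat => << Some i >> - x *: << Some (i.1, i.2.+1) >>
                              - rr (tower i.1 i.2) *: << None >> : P0).

Definition tel_d n :
    {linear {freeg (tel_index n.+1) / R} -> {freeg (tel_index n) / R}} :=
  match n with
  | 0 => tel_d0
  | _ => \0
  end.

Lemma tel_d0U k n : tel_d0 << (k, n) >> = << Some (k, n) >>
  - x *: << Some (k, n.+1) >> - rr (tower k n) *: << None >>.
Proof. exact: fglift1. Qed.

Lemma tel_augU k n : tel_aug << Some (k, n) >> = tower k n.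
Proof. exact: fglift1. Qed.

Lemma tel_augUN : tel_aug << None >> = e.
Proof. exact: fglift1. Qed.

Lemma tel_aug_d0 w : tel_aug (tel_d0 w) = 0.
Proof.
rewrite -[LHS]/((tel_aug \o tel_d0) w).
have /(_ w)// : tel_aug \o tel_d0 =1 \0.
apply: freeg_lin_ext => -[k n] /=; rewrite !fglift1 !linearB !linearZ /=.
by rewrite !fglift1 /= {1}towerE !scalerN addrK subrr.
Qed.

(** [tel_d0] is unitriangular along each tower, so the coefficients of [w] vanish by induction on
    [n]. *)
Lemma tel_d0_inj w : tel_d0 w = 0 -> w = 0.
Proof.
have c0 u k : coeff (Some (k, 0%N)) (tel_d0 u) = coeff (k, 0%N) u.
  elim/freeg_ind: u => [[j n]||u1 u2 IH1 IH2|a u IH].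
  - rewrite tel_d0U !coeffB !coeffZ !coeffU /= mul1r.
    by rewrite !(inj_eq Some_inj) !xpair_eqE /= andbF !mulr0 !subr0.
  - by rewrite linear0 !coeff0.
  - by rewrite linearD !coeffD IH1 IH2.
  - by rewrite linearZ !coeffZ IH.
have cS u k n : coeff (Some (k, n.+1)) (tel_d0 u)
    = coeff (k, n.+1) u - x * coeff (k, n) u.
  elim/freeg_ind: u => [[j i]||u1 u2 IH1 IH2|a u IH].
  - rewrite tel_d0U !coeffB !coeffZ !coeffU /= !mul1r mulr0 subr0.
    by rewrite !(inj_eq Some_inj) !xpair_eqE eqSS.
  - by rewrite linear0 !coeff0 mulr0 subr0.
  - by rewrite linearD !coeffD IH1 IH2 mulrDr opprD addrACA.
  - by rewrite linearZ !coeffZ IH mulrBr mulrCA.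
move=> dw; apply/eqP/freeg_eqP => -[k n]; rewrite coeff0.
elim: n => [|n IH]; first by rewrite -c0 dw coeff0.
by have := cS w k n; rewrite dw coeff0 IH mulr0 subr0.
Qed.

Let level n : {linear {freeg K / R} -> P0} :=
  fglift (fun k => << Some (k, n) >> : P0).

Let levelU n k : level n << k >> = << Some (k, n) >>.
Proof. exact: fglift1. Qed.

Lemma tel_level1 k n j : exists w b,
  << Some (k, n) >> = tel_d0 w + b *: << None >>
    + x ^+ j *: << Some (k, (n + j)%N) >> :> P0.
Proof.
elim: j => [|j [w [b IH]]].
  by exists 0, 0; rewrite linear0 scale0r !add0r expr0 scale1r addn0.
pose i := (k, (n + j)%N).
exists (w + x ^+ j *: << i >>), (b + x ^+ j * rr (tower k (n + j))).
rewrite IH linearD linearZ /= tel_d0U addnS exprSr !scalerBr !scalerA scalerDl.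
rewrite -[RHS]addrA -!(addrA (tel_d0 w)); congr (_ + _).
set s := x ^+ j *: _; set t := _ *: << Some _ >>; set q := _ *: << None >>.
by rewrite [in RHS](addrC q) !addrA subrK addrAC subrK addrC.
Qed.

(* Modulo the relations every element moves up to one common level, where the
   independence of [v] applies. *)
Lemma tel_level (u : P0) : exists n0, forall n, (n0 <= n)%N ->
  exists w b c, u = tel_d0 w + b *: << None >> + level n c.
Proof.
elim/freeg_ind: u => [[[k j]|]||u1 u2 [n1 IH1] [n2 IH2]|a u [n0 IH]].
- exists j => n jn; have [w [b]] := tel_level1 k j (n - j).
  rewrite subnKC // => ->; exists w, b, (x ^+ (n - j) *: << k >>).
  by rewrite linearZ /= levelU.
- exists 0%N => n _; exists 0, 1, 0.
  by rewrite !linear0 scale1r add0r addr0.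
- by exists 0%N => n _; exists 0, 0, 0; rewrite !linear0 scale0r !addr0.
- exists (maxn n1 n2) => n; rewrite geq_max => /andP[n1n n2n].
  have [w1 [b1 [c1 ->]]] := IH1 n n1n; have [w2 [b2 [c2 ->]]] := IH2 n n2n.
  exists (w1 + w2), (b1 + b2), (c1 + c2).
  by rewrite !linearD scalerDl /= addrACA; congr (_ + _); rewrite addrACA.
- exists n0 => n n0n; have [w [b [c ->]]] := IH n n0n.
  exists (a *: w), (a * b), (a *: c).
  by rewrite !linearZ /= !scalerDr scalerA.
Qed.

(** Modulo Re, [x ^+ n *: tower k n] is [v k]; multiplication by [x ^+ n] thus carries level [n]
    back to the independent family. *)
Lemma aug_level n c : exists b,
  x ^+ n *: tel_aug (level n c) = fglift v c + b *: e.
Proof.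
elim/freeg_ind: c => [k||c1 c2 [b1 IH1] [b2 IH2]|a c [b IH]].
- rewrite levelU tel_augU fglift1.
  suff [b ->] : exists b, v k = b *: e + x ^+ n *: tower k n.
    by exists (- b); rewrite scaleNr [_ *: e + _]addrC addrK.
  elim: n => [|n [b IH]]; first by exists 0; rewrite scale0r add0r expr0 scale1r.
  exists (b + x ^+ n * rr (tower k n)).
  by rewrite {1}IH {1}towerE scalerDr !scalerA addrA scalerDl exprSr.
- by exists 0; rewrite !linear0 scale0r addr0.
- exists (b1 + b2); rewrite !linearD /= IH1 IH2 scalerDl.
  by rewrite addrACA.
- exists (a * b).
  have -> : tel_aug (level n (a *: c)) = a *: tel_aug (level n c).
    by rewrite !linearZ.
  by rewrite scalerA mulrC -scalerA IH scalerDr scalerA [fglift v (a *: c)]linearZ.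
Qed.

Lemma tel_aug_surj y : exists u, tel_aug u = y.
Proof.
(* Trading [a] for [x ^+ n = c * a] suggests [c *: u] at level [n] as preimage: [x ^+ n] sends the
   error into Re, and [e_pure] removes that power. *)
have [a [u [r [a0 ay]]]] := v_gen y; have [n [c xn]] := x_cofinal a0.
have [b bP] := aug_level n (c *: u).
have [|s sP] := @e_pure (x ^+ n) (y - tel_aug (level n (c *: u))) (x_pow_neq0 n).
  exists (c * r - b).
  rewrite scalerBr bP xn -scalerA ay [fglift v (c *: u)]linearZ /= scalerDr scalerBl scalerA.
  by rewrite opprD addrACA subrr add0r.
exists (level n (c *: u) + s *: << None >>).
by rewrite linearD [tel_aug (s *: _)]linearZ /= tel_augUN -sP addrC subrK.
Qed.

(** At a common level, multiplying by [x ^+ n] turns the vanishing of the image into a relation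
    among the [v k]; independence gives [c = 0], and then [e_free] gives [b = 0]. *)
Lemma tel_exact0 u : tel_aug u = 0 -> exists w, tel_d0 w = u.
Proof.
have [n /(_ n (leqnn _))[w [b [c ->]]]] := tel_level u.
rewrite !linearD /= tel_aug_d0 linearZ /= tel_augUN add0r => bc.
have c0 : c = 0.
  have [b' bP] := aug_level n c.
  apply: (v_indep (r := - (x ^+ n * b) - b')).
  have: x ^+ n *: (b *: e + tel_aug (level n c)) = 0 by rewrite bc scaler0.
  rewrite scalerDr bP scalerA => /eqP; rewrite addrCA addr_eq0 => /eqP ->.
  by rewrite -scalerDl -scaleNr opprD.
have b0 : b = 0 by apply: e_free; move: bc; rewrite c0 !linear0 addr0.
by exists w; rewrite c0 b0 linear0 scale0r !addr0.
Qed.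

Lemma void_freeg0 (u : {freeg void / R}) : u = 0.
Proof. by apply/eqP/freeg_eqP => -[]. Qed.

Lemma tel_exact n y : tel_d n y = 0 <-> exists z, tel_d n.+1 z = y.
Proof.
case: n y => [|n] y /=; last first.
  by split=> // _; exists 0; rewrite (void_freeg0 y).
by split=> [/tel_d0_inj -> |[z <-]]; [exists 0 | rewrite linear0].
Qed.

(** Kept transparent, so that its terms from degree 2 on reduce to free modules on [void]. *)
Definition tel_resolution : proj_resolution M.
Proof.
apply: (@ProjResolution R M (fun n => {freeg (tel_index n) / R}) tel_d tel_aug).
- by move=> n; exact: freeg_projective.
- exact: tel_aug_surj.
- by move=> y; split=> [/tel_exact0//|[z <-]]; exact: tel_aug_d0.
- exact: tel_exact.
Defined.
End Resolution.

Lemma telescope_pd_le1 : pd_le M 1.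
Proof.
have [K [v [v_indep v_gen]]] := indep_maximal.
have [rr rP] : {rr : M -> R & forall y, exists w, y = rr y *: e + x *: w}.
  by exists (fun y => sval (cid (e_div y))) => y; case: cid.
have [ww rwP] : {ww : M -> M & forall y, y = rr y *: e + x *: ww y}.
  by exists (fun y => sval (cid (rP y))) => y; case: cid.
exists (tel_resolution v_indep v_gen rwP) => -[|[|n]] // _ y.
exact: void_freeg0.
Qed.

End Telescope.

(** * One-dimensional noetherian local domains *)

Section Ideals.
Variable R : comNzRingType.
Implicit Types (I J : submodClosed R^o) (U : R -> Prop).

(** Ideals as bare predicates, the unit ideal allowed; the lemmas below convert them to the bundled
    ideals occurring in [noetherian], [local_ring] and [prime_chain]. *)
Definition ideal_prop U := U 0 /\ forall a x y, U x -> U y -> U (a * x + y).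

Lemma ideal_prop_submod U : ideal_prop U ->
  exists I, forall x : R, x \in I <-> U x.
Proof.
move=> [U0 Ul]; pose S : {pred R^o} := fun x => `[< U x >].
have Sclosed : submod_closed S.
  split; first exact/asboolP.
  by move=> a x y /asboolP Ux /asboolP Uy; apply/asboolP/Ul.
pose g := GRing.isSubmodClosed.Build R R^o S Sclosed.
pose I : submodClosed R^o := HB.pack S g.
by exists I => x; split=> [/asboolP|Ux] //; exact/asboolP.
Qed.

Lemma ideal_prop_idealr U : ideal_prop U -> ~ U 1 ->
  exists p : idealr R, forall x : R, x \in p <-> U x.
Proof.
move=> [U0 Ul] U1; pose S : {pred R} := fun x => `[< U x >].
have Sclosed : idealr_closed S.
  split; [exact/asboolP|by apply/negP => /asboolP|].
  by move=> a x y /asboolP Ux /asboolP Uy; apply/asboolP/Ul.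
pose g := isIdealr.Build R S Sclosed.
pose I : idealr R := HB.pack S g.
by exists I => x; split=> [/asboolP|Ux] //; exact/asboolP.
Qed.

Lemma idealr_prop (p : idealr R) : ideal_prop (fun x => x \in p).
Proof.
split=> [|a x y xp yp]; first exact: idealr0.
by apply: rpredD => //; exact: idealMr.
Qed.

Lemma ideal_prop_prime U : ideal_prop U -> ~ U 1 ->
  (forall x y, U (x * y) -> U x \/ U y) ->
  exists p : prime_idealr R, forall x : R, x \in p <-> U x.
Proof.
move=> [U0 Ul] U1 Uprime; pose S : {pred R} := fun x => `[< U x >].
have Sclosed : idealr_closed S.
  split; [exact/asboolP|by apply/negP => /asboolP|].
  by move=> a x y /asboolP Ux /asboolP Uy; apply/asboolP/Ul.
have Sprime : prime_idealr_closed S.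
  by move=> x y /asboolP/Uprime[]?; apply/orP; [left|right]; exact/asboolP.
pose g := isIdealr.Build R S Sclosed.
pose g' := isPrimeIdealrClosed.Build R S Sprime.
pose I : prime_idealr R := HB.pack S g g'.
by exists I => x; split=> [/asboolP|Ux] //; exact/asboolP.
Qed.

Lemma ideal_prop_sum U : ideal_prop U -> forall (T : eqType) (s : seq T) (F : T -> R),
  (forall i, i \in s -> U (F i)) -> U (\sum_(i <- s) F i).
Proof.
move=> [U0 Ul] T s F UF; rewrite big_seq; elim/big_ind: _ => // x y Ux Uy.
by rewrite -[x]mul1r; exact: Ul.
Qed.

Lemma ideal_propM U : ideal_prop U -> forall a x, U x -> U (a * x).
Proof. by move=> [U0 Ul] a x Ux; rewrite -[a * x]addr0; exact: Ul. Qed.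

Lemma principal_ideal_prop b : ideal_prop (fun x => exists c, x = c * b).
Proof.
split=> [|a _ _ [c ->] [d ->]]; first by exists 0; rewrite mul0r.
by exists (a * c + d); rewrite mulrDl mulrA.
Qed.

Lemma ideal_prop_add U b : ideal_prop U ->
  ideal_prop (fun x => exists2 u, U u & exists c, x = u + c * b).
Proof.
move=> [U0 Ul]; split=> [|a _ _ [u Uu [c ->]] [u' Uu' [c' ->]]].
  by exists 0 => //; exists 0; rewrite mul0r addr0.
exists (a * u + u'); first exact: Ul.
by exists (a * c + c'); rewrite mulrDr mulrDl mulrA addrACA.
Qed.

Hypothesis Rnoeth : noetherian R.

(** Without a maximal member, choice yields a strictly increasing sequence in [F]. Its union is
    finitely generated, and the generators already lie in some [s N], where the sequence would
    stop. *)
Lemma noetherian_maximal (F : (R -> Prop) -> Prop) :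
  (forall U, F U -> ideal_prop U) -> (exists U, F U) ->
  exists2 U, F U & forall V, F V -> (forall x, U x -> V x) -> forall x, V x -> U x.
Proof.
move=> Fid [U0 FU0]; apply: contrapT => nmax.
have next (U : {U | F U}) :
    exists V : {V | F V}, (forall x, sval U x -> sval V x) /\
      exists2 x, sval V x & ~ sval U x.
  apply: contrapT => nV; apply: nmax; exists (sval U); first exact: svalP.
  move=> V FV UV x Vx; apply: contrapT => Ux; apply: nV.
  by exists (exist _ V FV); split=> //; exists x.
have [f fP] := choice next.
pose s n := iter n f (exist _ U0 FU0).
have smono i j x : (i <= j)%N -> sval (s i) x -> sval (s j) x.
  move=> ij; elim: j ij => [|j IH]; first by rewrite leqn0 => /eqP ->.
  rewrite leq_eqVlt => /orP[/eqP -> //|ij /(IH ij)].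
  exact: (fP (s j)).1.
have [|I IP] := @ideal_prop_submod (fun x => exists n, sval (s n) x).
  split; first by exists 0%N; exact: (Fid _ FU0).1.
  move=> a x y [i six] [j sjy]; exists (maxn i j).
  by apply: (Fid _ (svalP (s _))).2;
    [apply: smono six; exact: leq_maxl|apply: smono sjy; exact: leq_maxr].
have [g gP] := Rnoeth I.
have [N gN] : exists N, forall x, x \in g -> sval (s N) x.
  have: forall x, x \in g -> exists n, sval (s n) x.
    move=> x /(nthP 0)[i ig <-]; apply/IP/gP.
    (* Kronecker coefficients exhibit the generator itself as a member of [I]. *)
    exists (fun k : 'I_(size g) => (k == Ordinal ig)%:R).
    rewrite (bigD1 (Ordinal ig)) //= eqxx mul1r big1 ?addr0 // => k /negPf ->.
    by rewrite mul0r.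
  elim: (g) => [|x l IH] xl; first by exists 0%N.
  have [|N NP] := IH; first by move=> y yl; apply: xl; rewrite inE yl orbT.
  have [n nx] := xl x (mem_head _ _).
  exists (maxn n N) => y; rewrite inE => /orP[/eqP ->|/NP Ny].
    by apply: smono nx; exact: leq_maxl.
  by apply: smono Ny; exact: leq_maxr.
have [_ [x xS xN]] := fP (s N); apply: xN.
have /gP[c ->] : x \in I by apply/IP; exists N.+1.
apply: (ideal_prop_sum (Fid _ (svalP (s N)))) => k _.
by apply: (ideal_propM (Fid _ (svalP (s N)))); apply: gN; exact: mem_nth.
Qed.

Section Local.
Variable m : idealr R.
Hypothesis Rlocal : local_ring m.

(** An ideal maximal among the proper ones containing [x] is a maximal ideal, hence equals [m]. *)
Lemma proper_sub_max U : ideal_prop U -> ~ U 1 -> forall x, U x -> x \in m.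
Proof.
move=> Uid U1 x Ux.
pose F V := [/\ ideal_prop V, ~ V 1 & V x].
have [|| V [Vid V1 Vx] Vmax] := @noetherian_maximal F; first by move=> V [].
  by exists U.
have [J JP] := ideal_prop_idealr Vid V1.
rewrite -((Rlocal.2 J _) x); first exact/JP.
move=> K JK y yK; apply/JP/(Vmax (fun x => x \in K)) => //.
  by split; [exact: idealr_prop|rewrite idealr1|apply/JK/JP].
by move=> z /JP/JK.
Qed.

Lemma notin_max_inv a : a \notin m -> exists c, c * a = 1.
Proof.
move=> am; apply: contrapT => na; case/negP: am.
apply: (proper_sub_max (principal_ideal_prop a)).
  by move=> [c ca]; apply: na; exists c.
by exists 1; rewrite mul1r.
Qed.

Lemma max_prime x y : x * y \in m -> x \in m \/ y \in m.
Proof.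
move=> xy; apply: contrapT => /not_orP[/negP/notin_max_inv[c cx]].
move=> /negP/notin_max_inv[d dy]; have /negP[] := negbT (idealr1 m).
have -> : 1 = (c * d) * (x * y) by rewrite mulrACA cx dy mulr1.
exact: idealMr.
Qed.

Lemma ideal_pow_prop n : ideal_prop (fun x => x \in ideal_pow m n).
Proof.
by have [I0 Il] := ideal_pow_submod_closed m n; split=> // a x y; exact: Il.
Qed.

Lemma ideal_pow_mull n u w : u \in m -> w \in ideal_pow m n ->
  u * w \in ideal_pow m n.+1.
Proof.
move=> um wn; apply/asboolP; exists [:: (u, w)]; rewrite big_seq1; split=> // v.
by rewrite inE => /eqP ->.
Qed.

Lemma ideal_powS_ind n U : ideal_prop U ->
  (forall u w, u \in m -> w \in ideal_pow m n -> U (u * w)) ->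
  forall x, x \in ideal_pow m n.+1 -> U x.
Proof.
move=> Uid Um x /asboolP[s [sP ->]].
by apply: (ideal_prop_sum Uid) => u /sP[]; exact: Um.
Qed.

Lemma ideal_powD_ind k l U : ideal_prop U ->
  (forall u w, u \in ideal_pow m k -> w \in ideal_pow m l -> U (u * w)) ->
  forall x, x \in ideal_pow m (k + l) -> U x.
Proof.
elim: k U => [|k IH] U Uid Ukl x; first by move=> xl; rewrite -[x]mul1r; exact: Ukl.
rewrite addSn; apply: ideal_powS_ind => // a w am.
(* The induction hypothesis is applied to the colon ideal of [U] by [a]. *)
have aU : ideal_prop (fun y => U (a * y)).
  split=> [|b y z Uy Uz]; first by rewrite mulr0; exact: Uid.1.
  by rewrite mulrDr mulrCA; exact: Uid.2.
apply: (IH _ aU) => u v uk vl; rewrite mulrA; apply: Ukl => //.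
exact: ideal_pow_mull.
Qed.

Lemma exp_ideal_pow n x : x \in m -> x ^+ n \in ideal_pow m n.
Proof. by move=> xm; elim: n => // n IH; rewrite exprS ideal_pow_mull. Qed.

Lemma ideal_pow_le k n x : (k <= n)%N ->
  x \in ideal_pow m n -> x \in ideal_pow m k.
Proof.
move=> kn; elim: n kn => [|n IH]; first by rewrite leqn0 => /eqP ->.
by rewrite leq_eqVlt => /orP[/eqP -> //|kn /ideal_powS/IH]; exact.
Qed.

Lemma ideal_pow1_sub x : x \in ideal_pow m 1 -> x \in m.
Proof.
apply: (ideal_powS_ind (idealr_prop m)).
by move=> u w um _; rewrite mulrC; exact: idealMr.
Qed.
End Local.
End Ideals.

(** * Powers of the maximal ideal in dimension one *)

Section DimensionOne.
Variables (R : idomainType) (m : idealr R).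
Hypotheses (Rnoeth : noetherian R) (Rlocal : local_ring m).
Hypothesis Rdim : has_krull_dim R 1.

Lemma max_ideal_neq0 : exists2 x, x \in m & x != 0.
Proof.
have [[p pP] _] := Rdim; have [_ p1] := pP 0%N isT.
have [x x1 x0] : exists2 x, x \in p 1%N & x \notin p 0%N.
  apply: contrapT => nx; apply: p1 => x x1; apply/negPn/negP => x0.
  by apply: nx; exists x.
exists x; last by apply: contraNneq x0 => ->; exact: idealr0.
apply: (proper_sub_max Rnoeth Rlocal (idealr_prop (p 1%N))) => //.
by rewrite idealr1.
Qed.

(** Otherwise 0, [U] and [m] would form a strict chain of three primes. *)
Lemma prime_eq_max (U : R -> Prop) : ideal_prop U -> ~ U 1 ->
  (forall x y, U (x * y) -> U x \/ U y) -> (exists2 x, U x & x != 0) ->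
  forall x, x \in m -> U x.
Proof.
move=> Uid U1 Uprime [b Ub b0] x xm; apply: contrapT => Ux.
have [p0 p0P] : exists p : prime_idealr R, forall x : R, x \in p <-> x = 0.
  apply: (@ideal_prop_prime _ (fun x => x = 0)).
  - by split=> // a _ _ -> ->; rewrite mulr0 addr0.
  - by apply/eqP; rewrite oner_eq0.
  - by move=> y z /eqP; rewrite mulf_eq0 => /orP[]/eqP; [left|right].
have [p1 p1P] := ideal_prop_prime Uid U1 Uprime.
have [p2 p2P] : exists p : prime_idealr R, forall x : R, x \in p <-> x \in m.
  apply: (ideal_prop_prime (idealr_prop m)); first by rewrite idealr1.
  exact: max_prime.
have /Rdim.2 // : prime_chain R 2.
exists (fun n => match n with 0 => p0 | 1 => p1 | _ => p2 end).
move=> [|[|n]] // _; split.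
- by move=> y /p0P ->; exact: idealr0.
- by move=> /(_ b); rewrite p1P p0P => /(_ Ub)/eqP; apply/negP.
- by move=> y /p1P Uy; apply/p2P; exact: (proper_sub_max Rnoeth Rlocal Uid).
- by move=> /(_ x); rewrite p1P p2P => /(_ xm).
Qed.

(** Noetherian induction: a maximal counterexample [V] is not prime, as it would then contain [m].
    If [b * c] is in [V] but [b] and [c] are not, then V + Rb and V + Rc contain powers of [m], and
    their product lies in [V]. *)
Lemma ideal_contains_pow (U : R -> Prop) : ideal_prop U ->
  (exists2 x, U x & x != 0) -> exists n, forall x, x \in ideal_pow m n -> U x.
Proof.
move=> Uid U0; apply: contrapT => Un.
pose F V := [/\ ideal_prop V, exists2 x, V x & x != 0 &
  ~ exists n, forall x, x \in ideal_pow m n -> V x].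
have [|| V [Vid V0 Vn] Vmax] := @noetherian_maximal _ Rnoeth F.
- by move=> V [].
- by exists U.
have V1 : ~ V 1.
  by move=> V1; apply: Vn; exists 0%N => x _; rewrite -[x]mulr1; exact: ideal_propM.
have [b [c [Vb Vc Vbc]]] : exists b c, [/\ ~ V b, ~ V c & V (b * c)].
  apply: contrapT => nbc; apply: Vn; exists 1%N => x /ideal_pow1_sub.
  apply: prime_eq_max => // y z Vyz; apply: contrapT => /not_orP[Vy Vz].
  by apply: nbc; exists y, z.
have grow d : ~ V d -> exists n, forall x, x \in ideal_pow m n ->
    exists2 u, V u & exists r, x = u + r * d.
  move=> Vd; apply: contrapT => nd; apply: Vd.
  pose W x := exists2 u, V u & exists r, x = u + r * d.
  have VW x : V x -> W x by exists x => //; exists 0; rewrite mul0r addr0.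
  apply: (Vmax W) => //.
    split=> //; first exact: ideal_prop_add.
    by have [x /VW Wx x0] := V0; exists x.
  by exists 0; [exact: Vid.1|exists 1; rewrite mul1r add0r].
have [k kP] := grow b Vb; have [l lP] := grow c Vc.
apply: Vn; exists (k + l)%N; apply: ideal_powD_ind => // u w /kP[v Vv [r ->]].
move=> /lP[v' Vv' [r' ->]].
rewrite mulrDl mulrC; apply: Vid.2 => //; rewrite mulrDr.
by apply: Vid.2 => //; rewrite mulrACA; exact: ideal_propM.
Qed.

(** If m^k lies in aR, then m^(n + k) = m^n m^k lies in a m^n. This Artin-Rees type bound controls
    the divisions in the completion. *)
Lemma ideal_pow_sub_principal a : a != 0 -> exists k, forall n x,
  x \in ideal_pow m (n + k) -> exists2 z, z \in ideal_pow m n & x = a * z.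
Proof.
move=> a0; have [|k kP] := ideal_contains_pow (principal_ideal_prop a).
  by exists a => //; exists 1; rewrite mul1r.
exists k => n; have nid := ideal_pow_prop m n.
apply: ideal_powD_ind.
  split=> [|b _ _ [z zn ->] [z' zn' ->]]; first by exists 0; [exact: nid.1|rewrite mulr0].
  by exists (b * z + z'); [exact: nid.2|rewrite mulrDr mulrCA].
move=> u w un /kP[c ->]; exists (c * u); first exact: ideal_propM nid _ _ un.
by rewrite mulrA mulrC [u * c]mulrC.
Qed.

Lemma exp_dvd a x : x \in m -> a != 0 -> exists n c, x ^+ n = c * a.
Proof.
move=> xm a0; have [|k kP] := ideal_contains_pow (principal_ideal_prop a).
  by exists a => //; exists 1; rewrite mul1r.
by have [c xc] := kP _ (exp_ideal_pow k xm); exists k, c.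
Qed.

Lemma krull_intersection u : (forall n, u \in ideal_pow m n) -> u = 0.
Proof.
move=> um; apply/eqP/negPn/negP => u0.
have [x xm x0] := max_ideal_neq0.
(* Dividing [u] by [x * u] and cancelling [u] makes [x] a unit, although it lies in [m]. *)
have [k kP] := @ideal_pow_sub_principal (x * u) (mulf_neq0 x0 u0).
have [z _] := kP 0%N u (um _); rewrite mulrAC -{1}[u]mul1r => /(mulIf u0) xz.
by have := idealr1 m; rewrite xz mulrC idealMr.
Qed.
End DimensionOne.

(** * The completion *)

Section CompletionRepresentatives.
Variables (R : comNzRingType) (m : idealr R).
Implicit Types (y : completion m) (z : nat -> R).

Definition repr_by y z := forall n, val y n = adic_proj m n (z n).

Lemma adic_projP n a b :
  adic_proj m n a = adic_proj m n b <-> a - b \in ideal_pow m n.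
Proof. exact: (@quotmod_piP _ _ (ideal_pow m n)). Qed.

Lemma completionP y y' : (forall n, val y n = val y' n) -> y = y'.
Proof. by move=> yy; apply: val_inj; apply: functional_extensionality_dep. Qed.

Lemma completion_repr y : exists2 z, repr_by y z &
  forall n, z n.+1 - z n \in ideal_pow m n.
Proof.
have [z zP] : {z | repr_by y z}.
  have h n : {a | val y n = adic_proj m n a}.
    by apply: cid; have [a ->] := quotmod_pi_surj (val y n); exists a.
  by exists (fun n => sval (h n)) => n; exact: (svalP (h n)).
exists z => // n; apply/adic_projP.
by have /asboolP/(_ _ _ (zP n.+1)) <- := valP y; rewrite zP.
Qed.

Lemma completion_of_seq z : (forall n, z n.+1 - z n \in ideal_pow m n) ->
  exists y, repr_by y z.
Proof.
move=> zS; pose f : dprod (adic_quot m) := fun n => adic_proj m n (z n).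
have fc : f \in coherent m.
  apply/asboolP => n a fa; rewrite -(adic_projS fa).
  by apply/esym/adic_projP; exact: zS.
by exists (Submod fc).
Qed.

Lemma repr_by_eq y y' z z' : repr_by y z -> repr_by y' z' ->
  (forall n, z n - z' n \in ideal_pow m n) -> y = y'.
Proof.
by move=> yz yz' zz; apply: completionP => n; rewrite yz yz'; apply/adic_projP.
Qed.

Lemma repr_by_inj y z z' : repr_by y z -> repr_by y z' ->
  forall n, z n - z' n \in ideal_pow m n.
Proof. by move=> yz yz' n; apply/adic_projP; rewrite -yz -yz'. Qed.

Lemma repr_byD y y' z z' : repr_by y z -> repr_by y' z' ->
  repr_by (y + y') (fun n => z n + z' n).
Proof.
move=> yz yz' n; rewrite -[LHS]/(val y n + val y' n) yz yz'.
by apply/esym; exact: (quotmod_piD (ideal_pow m n)).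
Qed.

Lemma repr_byZ a y z : repr_by y z -> repr_by (a *: y) (fun n => a * z n).
Proof.
move=> yz n; rewrite -[LHS]/(a *: val y n) yz.
exact: (@quotmod_piZ _ _ (ideal_pow m n)).
Qed.

Local Notation e := (to_completion m 1).

Lemma repr_by_scalar a : repr_by (a *: e) (fun=> a).
Proof. by move=> n; rewrite (@repr_byZ a e (fun=> 1)) ?mulr1. Qed.

Lemma to_completionE a : to_completion m a = a *: e.
Proof. by apply: completionP => n; rewrite repr_by_scalar. Qed.

Lemma repr_by_tail y z : repr_by y z ->
  (forall n, z n.+1 - z n \in ideal_pow m n) ->
  forall n k, z (n + k)%N - z n \in ideal_pow m n.
Proof.
move=> yz zS n; elim=> [|k IH]; first by rewrite addn0 subrr rpred0.
rewrite -[_ - _](subrKA (z (n + k)%N)) rpredD // addnS.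
by apply: ideal_pow_le (zS _); exact: leq_addr.
Qed.

Lemma repr_by_shift y z k : repr_by y z ->
  (forall n, z n.+1 - z n \in ideal_pow m n) ->
  repr_by y (fun n => z (k + n)%N).
Proof.
move=> yz zS n; rewrite yz; apply/adic_projP.
by rewrite -rpredN opprB addnC; exact: repr_by_tail.
Qed.
End CompletionRepresentatives.

(** * The completion of a one-dimensional domain *)

Section CompletionDimensionOne.
Variables (R : idomainType) (m : idealr R).
Hypotheses (Rnoeth : noetherian R) (Rlocal : local_ring m).
Hypothesis Rdim : has_krull_dim R 1.

Local Notation e := (to_completion m 1).

Lemma completion_scalar_inj a : a *: e = 0 -> a = 0.
Proof.
move=> ae0; apply: (krull_intersection Rnoeth Rlocal Rdim) => n.
have e0 : repr_by (a *: e) (fun=> 0).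
  by move=> k; rewrite ae0 -[0 in LHS](scale0r e) repr_by_scalar.
by have := repr_by_inj (repr_by_scalar m a) e0 n; rewrite subr0.
Qed.

(** From index [k] on, the increments of a representing sequence are [x * w n] with [w n] in m^n.
    The partial sums of [w] define the quotient, and [z k] is the remainder. *)
Lemma completion_divisible x : x != 0 ->
  forall y : completion m, exists r w, y = r *: e + x *: w.
Proof.
move=> x0 y; have [z yz zS] := completion_repr y.
have [k kP] := ideal_pow_sub_principal Rnoeth Rlocal Rdim x0.
have [w wP] : {w : nat -> R & forall n, w n \in ideal_pow m n /\
    z (k + n).+1 - z (k + n)%N = x * w n}.
  have h n : {a | a \in ideal_pow m n /\ z (k + n).+1 - z (k + n)%N = x * a}.
    apply: cid; have [|a an ax] := kP n (z (k + n).+1 - z (k + n)%N).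
      by rewrite addnC; exact: zS.
    by exists a.
  by exists (fun n => sval (h n)) => n; exact: (svalP (h n)).
have [|v vP] := @completion_of_seq _ m (fun n => \sum_(i < n) w i).
  by move=> n; rewrite big_ord_recr /= addrAC subrr add0r; have [] := wP n.
exists (z k), v; apply: repr_by_eq (repr_by_shift k yz zS) _ _.
  exact: repr_byD (repr_by_scalar _ _) (repr_byZ x vP).
move=> n /=; suff -> : z (k + n)%N = z k + x * \sum_(i < n) w i.
  by rewrite subrr rpred0.
elim: n => [|n IH]; first by rewrite addn0 big_ord0 mulr0 addr0.
rewrite big_ord_recr /= mulrDr addrA -IH -(wP n).2 addnS.
by rewrite addrC subrK.
Qed.

(** Since [a * z k - r] lies in m^k, [a] divides [r], say [r = a * s]. Then [a * (z (k + n) - s)]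
    lies in a m^n, and cancelling [a] shows that [z] converges to [s]. *)
Lemma completion_pure a (y : completion m) : a != 0 ->
  (exists r, a *: y = r *: e) -> exists r, y = r *: e.
Proof.
move=> a0 [r ar]; have [z yz zS] := completion_repr y.
have [k kP] := ideal_pow_sub_principal Rnoeth Rlocal Rdim a0.
have azr n : a * z n - r \in ideal_pow m n.
  have := repr_by_inj (repr_byZ a yz); rewrite ar => /(_ _ (repr_by_scalar m r)).
  exact.
have [s _ rs] : exists2 s, s \in ideal_pow m 0 & r = a * s.
  have [s _ rs] := kP 0%N _ (azr k); exists (z k - s) => //.
  by rewrite mulrBr -rs opprB addrC subrK.
exists s; apply: repr_by_eq (repr_by_shift k yz zS) (repr_by_scalar _ _) _ => n.
have [t tn] := kP n _ (eq_ind _ (fun j => a * z j - r \in ideal_pow m j)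
  (azr (k + n)%N) _ (addnC k n)).
by rewrite addnC rs -mulrBr => /(mulfI a0) ->.
Qed.

Lemma completion_separated x (w : completion m) : x \in m ->
  (forall n, exists v, w = x ^+ n *: v) -> w = 0.
Proof.
move=> xm wx; have [z wz zS] := completion_repr w.
rewrite -(scale0r e); apply: (repr_by_eq wz (repr_by_scalar _ _)) => n.
have [v wv] := wx n; have [t vt _] := completion_repr v.
have := repr_by_inj wz; rewrite wv => /(_ _ (repr_byZ (x ^+ n) vt) n) zt.
rewrite subr0 -[z n](subrK (x ^+ n * t n)) rpredD // mulrC.
by apply: ideal_propM (ideal_pow_prop m n) _ _ _; exact: exp_ideal_pow.
Qed.

Lemma completion_pd_le1 : pd_le (completion m) 1.
Proof.
have [x xm x0] := max_ideal_neq0 Rnoeth Rlocal Rdim.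
apply: (@telescope_pd_le1 _ _ e x).
- by move=> a /eqP; rewrite mulf_eq0 (negPf x0) => /eqP.
- exact: completion_scalar_inj.
- exact: completion_divisible.
- exact: completion_pure.
- by move=> a; exact: (exp_dvd Rnoeth Rlocal Rdim).
Qed.

Lemma completion_projective_complete :
  projective (completion m) -> adically_complete m.
Proof.
move=> Cproj; have [x xm x0] := max_ideal_neq0 Rnoeth Rlocal Rdim.
have e0 : e != 0.
  apply/eqP => e0; have /eqP := @completion_scalar_inj 1 (etrans (scale1r _) e0).
  by rewrite oner_eq0.
have [f fe0] := projective_dual Cproj e0.
have fE y : f y *: e = f e *: y.
  apply/eqP; rewrite -subr_eq0; apply/eqP.
  apply: (completion_separated xm) => n.
  (* The contribution of [r *: e] cancels in [f y *: e - f e *: y], which leaves a multiple of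
     [x ^+ n]. *)
  have [r [w yw]] := completion_divisible (expf_neq0 n x0) y.
  exists (f w *: e - f e *: w).
  have -> : f y = r * f e + x ^+ n * f w by rewrite yw linearD !linearZ.
  rewrite yw scalerDl scalerDr scalerBr !scalerA opprD addrACA.
  by rewrite [r * _]mulrC subrr add0r [f e * _]mulrC.
have eR y : exists r, y = r *: e.
  by apply: (completion_pure fe0); exists (f y).
exists (fun y => sval (cid (eR y))) => [a|y].
  case: cid => r /= /eqP; rewrite to_completionE -subr_eq0 -scalerBl => /eqP.
  by move=> /completion_scalar_inj/eqP; rewrite subr_eq0 => /eqP.
by case: cid => r /= yr; rewrite to_completionE -yr.
Qed.
End CompletionDimensionOne.

(** As [P 1 = 0], the augmentation is injective, so its set-theoretic section is linear and carries
    projectivity from [P 0] to [M]. *)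
Lemma pd_le0_projective (R : comNzRingType) (M : lmodType R) :
  pd_le M 0 -> projective M.
Proof.
case=> P P0 N N' g f gsurj.
have aug_inj y : res_aug P y = 0 -> y = 0.
  by move=> /res_exact0[z <-]; rewrite (P0 1%N isT z) linear0.
have [h hP] := @res_proj _ _ P 0 N N' g (f \o res_aug P) gsurj.
have [s sK] : {s : M -> P 0%N & forall x, res_aug P (s x) = x}.
  by exists (fun x => sval (cid (res_aug_surj P x))) => x; case: cid.
have slin : linear s.
  move=> a x y; apply/eqP; rewrite -subr_eq0; apply/eqP/aug_inj.
  by rewrite linearB linearP !sK subrr.
pose s' : {linear M -> P 0%N} :=
  HB.pack s (GRing.isLinear.Build R M (P 0%N) _ s slin).
by exists (h \o s') => x; rewrite /= hP /= sK.
Qed.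

Theorem corollary8p2 (R : idomainType) (m : idealr R)
    (Rnoeth : noetherian R) (Rlocal : local_ring m) (Rdim : has_krull_dim R 1)
    (Rncomplete : ~ adically_complete m) :
  has_pd (completion m) 1 /\
  forall (P : proj_resolution (completion m)) (i : nat), (2 <= i)%N ->
    forall e : Ext P R^o i, e = 0.
Proof.
have pd1 := completion_pd_le1 Rnoeth Rlocal Rdim.
split; last by move=> P i; exact: Ext_pd_le1.
split=> // -[|k] // /pd_le0_projective Cproj; case: Rncomplete.
exact: (completion_projective_complete Rnoeth Rlocal Rdim).
Qed.
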